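(* Let $(\mathbb{P}/\mathfrak{D}_2)(t,q)$ be the generating series, with $t$ marking the half-perimeter and $q$ marking the area, of congruence-type parallelogram polyominoes, i.e. of orbits of the set of parallelogram polyominoes (up to translation) under the action of $\mathfrak{D}_2=\{1,r^2,d_1,d_2\}$. Then $$(\mathbb{P}/\mathfrak{D}_2)(t,q)=\frac14\bigl(\mathbb{P}(1,t,t,q)+R_2(t,t,q)+D_1(t,t,q)+D_2(t,t,q)\bigr),$$ where $\mathbb{P}(v,x,y,q)$ is the generating series of all parallelogram polyominoes with $v,x,y,q$ marking the height of the rightmost column, the width, the height and the area, and $R_2(x,y,q)$, $D_1(x,y,q)$, $D_2(x,y,q)$ are the generating series of the $r^2$-symmetric, $d_1$-symmetric and $d_2$-symmetric parallelogram polyominoes respectively, with $x,y,q$ marking the width, the height and the area.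
   Context: A parallelogram polyomino is a finite nonempty connected set of unit cells of the square lattice, considered up to translation, whose intersection with every row and every column of cells is a contiguous block (or empty), and which contains the bottom-left and the top-right cells of its minimal bounding rectangle. Equivalently, with columns numbered $1,\dots,w$ from left to right, column $i$ occupies the rows $b_i,\dots,t_i$ with $b_i\le b_{i+1}\le t_i\le t_{i+1}$ for $1\le i<w$. The half-perimeter is the sum of the width and the height of the minimal bounding rectangle; the area is the number of cells. The group $\mathfrak{D}_2=\{1,r^2,d_1,d_2\}$, consisting of the identity, the rotation $r^2$ by $180^\circ$, and the reflections $d_1$, $d_2$ about lines parallel to the bisector of the second quadrant ($y=-x$) and of the first quadrant ($y=x$) respectively, acts on parallelogram polyominoes and preserves half-perimeter and area. A polyomino is $g$-symmetric if it equals, up to translation, its image under $g$. *)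

(* Defs.v *)
From HB Require Import structures.
From mathcomp Require Import all_boot all_order all_algebra.
From mathcomp Require Import generic_quotient finmap.
From mathcomp Require Import boolp classical_sets functions cardinality fsbigop.
From mathcomp.multinomials Require Import mpoly.
From mathcomp Require Import ring.

Set Implicit Arguments.
Unset Strict Implicit.
Unset Printing Implicit Defensive.

Import Order.TTheory GRing.Theory Num.Theory.

Local Open Scope quotient_scope.
Local Open Scope classical_set_scope.
Local Open Scope ring_scope.

(* The cell (i, j) is the unit square [i, i+1] x [j, j+1]: i is its column and
   j its row, rows being numbered upwards. *)
Definition cell : Type := (int * int)%type.
HB.instance Definition _ := Choice.on cell.

Definition shape : Type := {fset cell}.
HB.instance Definition _ := Choice.on shape.

Implicit Types (c : cell) (A B : shape).

(* The initial value of the iterated minimum is attained as soon as A is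
   nonempty; extent f A is then the length of the f-side of the bounding box. *)
Definition coord_min (f : cell -> int) (A : shape) : int :=
  \big[Order.min/f (head (0, 0) (A : seq cell))]_(c <- (A : seq cell)) f c.

Definition coord_max (f : cell -> int) (A : shape) : int :=
  \big[Order.max/f (head (0, 0) (A : seq cell))]_(c <- (A : seq cell)) f c.

Definition extent (f : cell -> int) (A : shape) : nat :=
  `|coord_max f A - coord_min f A|%N.+1.

Definition xmin : shape -> int := coord_min fst.
Definition xmax : shape -> int := coord_max fst.
Definition ymin : shape -> int := coord_min snd.
Definition ymax : shape -> int := coord_max snd.

Definition width (A : shape) : nat := extent fst A.
Definition height (A : shape) : nat := extent snd A.
Definition half_perimeter (A : shape) : nat := (width A + height A)%N.
Definition area (A : shape) : nat := #|` A|.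
Definition last_column_height (A : shape) : nat :=
  #|` [fset c in A | c.1 == xmax A]%fset|.

Definition adjacent : rel cell :=
  fun c c' => (`|c.1 - c'.1| + `|c.2 - c'.2| == 1)%N.

Definition connected (A : shape) : Prop :=
  forall c c', c \in A -> c' \in A ->
  exists p : seq cell,
    [/\ path adjacent c p, last c p = c' & {subset p <= A}].

Definition row_convex (A : shape) : Prop :=
  forall i i' k j : int,
    (i, j) \in A -> (i', j) \in A -> i <= k <= i' -> (k, j) \in A.

Definition column_convex (A : shape) : Prop :=
  forall i j j' k : int,
    (i, j) \in A -> (i, j') \in A -> j <= k <= j' -> (i, k) \in A.

Record parallelogram (A : shape) : Prop := Parallelogram {
  parallelogram_neq0 : A != fset0;
  parallelogram_connected : connected A;
  parallelogram_rows : row_convex A;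
  parallelogram_columns : column_convex A;
  parallelogram_bottom_left : (xmin A, ymin A) \in A;
  parallelogram_top_right : (xmax A, ymax A) \in A
}.

Definition shift (v c : cell) : cell := (c.1 + v.1, c.2 + v.2).

Definition translate (v : cell) (A : shape) : shape :=
  [fset shift v c | c in A]%fset.

Definition translation_equiv : rel shape :=
  fun A B => `[< exists v, B = translate v A >].

Lemma translateM u v A : translate u (translate v A) = translate (shift u v) A.
Proof.
apply/fsetP => c; apply/imfsetP/imfsetP => -[/= d dA ->].
  move: dA => /imfsetP[/= e eA ->]; exists e => //.
  by rewrite /shift /= -!addrA.
exists (shift v d); first by apply/imfsetP; exists d.
by rewrite /shift /= -!addrA.
Qed.

Lemma translate0 A : translate (0, 0) A = A.
Proof.
have shift0 c : shift (0, 0) c = c by case: c => i j; rewrite /shift /= !addr0.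
apply/fsetP => c; apply/imfsetP/idP => [[/= d dA ->]|cA]; first by rewrite shift0.
by exists c; rewrite ?shift0.
Qed.

Lemma translateK v A : translate (- v.1, - v.2) (translate v A) = A.
Proof. by rewrite translateM /shift /= !subrr translate0. Qed.

Lemma translation_equiv_refl : reflexive translation_equiv.
Proof. by move=> A; apply/asboolP; exists (0, 0); rewrite translate0. Qed.

Lemma translation_equiv_sym : ssrbool.symmetric translation_equiv.
Proof.
suff imp A B : translation_equiv A B -> translation_equiv B A.
  by move=> A B; apply/idP/idP; apply: imp.
by move=> /asboolP[v ->]; apply/asboolP; exists (- v.1, - v.2); rewrite translateK.
Qed.

Lemma translation_equiv_trans : transitive translation_equiv.
Proof.
move=> B A C /asboolP[v ->] /asboolP[u ->]; apply/asboolP.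
by exists (shift u v); rewrite translateM.
Qed.

Canonical translation_equiv_rel := EquivRel translation_equiv
  translation_equiv_refl translation_equiv_sym translation_equiv_trans.

(* Finite sets of cells up to translation. Being a parallelogram polyomino, the
   width, the height, the area and the height of the last column are invariant
   under translation, so they may be read off any representative. *)
Definition tclass : Type := {eq_quot translation_equiv}.
HB.instance Definition _ := Choice.on tclass.
HB.instance Definition _ := EqQuotient.on tclass.

(* The identity, the rotation by 180 degrees, and the reflections about the
   lines y = -x and y = x. *)
Inductive D2 : Type := id_ | r2 | d1 | d2.

(* The image of the square [i, i+1] x [j, j+1] under the isometry g of the plane
   fixing the origin; the -1 come from naming a cell by its lower-left corner. *)
Definition move_cell (g : D2) (c : cell) : cell :=
  match g with
  | id_ => c
  | r2 => (- c.1 - 1, - c.2 - 1)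
  | d1 => (- c.2 - 1, - c.1 - 1)
  | d2 => (c.2, c.1)
  end.

Definition move (g : D2) (A : shape) : shape :=
  [fset move_cell g c | c in A]%fset.

Definition act (g : D2) (C : tclass) : tclass :=
  \pi_tclass (move g (repr C)).

Definition symmetric_under (g : D2) (C : tclass) : Prop := act g C = C.

Definition congruent : rel tclass :=
  fun C C' => `[< exists g, C' = act g C >].

Definition mulD2 (g h : D2) : D2 :=
  match g, h with
  | id_, k | k, id_ => k
  | r2, r2 | d1, d1 | d2, d2 => id_
  | r2, d1 | d1, r2 => d2
  | r2, d2 | d2, r2 => d1
  | d1, d2 | d2, d1 => r2
  end.

Lemma moveM g h A : move g (move h A) = move (mulD2 g h) A.
Proof.
have cellM c : move_cell g (move_cell h c) = move_cell (mulD2 g h) c.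
  by case: c => i j; case: g; case: h => //=; congr pair; ring.
apply/fsetP => c; apply/imfsetP/imfsetP => -[/= d dA ->].
  by move: dA => /imfsetP[/= e eA ->]; exists e.
by exists (move_cell h d); rewrite ?cellM //; apply/imfsetP; exists d.
Qed.

Lemma move_id A : move id_ A = A.
Proof.
by apply/fsetP => c; apply/imfsetP/idP => [[/= d dA ->]//|cA]; exists c.
Qed.

Lemma move_translate g v A :
  exists u, move g (translate v A) = translate u (move g A).
Proof.
pose u : cell := match g with
  | id_ => v | r2 => (- v.1, - v.2) | d1 => (- v.2, - v.1) | d2 => (v.2, v.1) end.
have cellE c : move_cell g (shift v c) = shift u (move_cell g c).
  by rewrite /u {u}; case: c => i j; case: g; rewrite /shift //=; congr pair; ring.
exists u; apply/fsetP => c; apply/imfsetP/imfsetP => -[/= d dA ->];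
  move: dA => /imfsetP[/= e eA ->].
  by exists (move_cell g e); rewrite ?cellE //; apply/imfsetP; exists e.
by exists (shift v e); rewrite ?cellE //; apply/imfsetP; exists e.
Qed.

Lemma act_pi g A : act g (\pi_tclass A) = \pi_tclass (move g A).
Proof.
apply/eqmodP/asboolP.
have : translation_equiv (repr (\pi_tclass A)) A by apply/eqmodP; rewrite reprK.
by move: (repr _) => B /asboolP[v ->]; exact: move_translate.
Qed.

Lemma actM g h C : act g (act h C) = act (mulD2 g h) C.
Proof. by rewrite {2}/act act_pi moveM. Qed.

Lemma act_id C : act id_ C = C.
Proof. by rewrite /act move_id reprK. Qed.

Lemma congruent_refl : reflexive congruent.
Proof. by move=> C; apply/asboolP; exists id_; rewrite act_id. Qed.

Lemma congruent_sym : ssrbool.symmetric congruent.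
Proof.
suff imp C C' : congruent C C' -> congruent C' C.
  by move=> C C'; apply/idP/idP; apply: imp.
move=> /asboolP[g ->]; apply/asboolP; exists g.
by rewrite actM; case: g; rewrite /= act_id.
Qed.

Lemma congruent_trans : transitive congruent.
Proof.
move=> C' C C'' /asboolP[h ->] /asboolP[g ->]; apply/asboolP.
by exists (mulD2 g h); rewrite actM.
Qed.

Canonical congruent_rel := EquivRel congruent
  congruent_refl congruent_sym congruent_trans.

Definition congruence_class : Type := {eq_quot congruent}.
HB.instance Definition _ := Choice.on congruence_class.
HB.instance Definition _ := EqQuotient.on congruence_class.

Definition PP : set tclass := [set C | parallelogram (repr C)].

Definition PP_mod_D2 : set congruence_class := [set \pi_congruence_class C | C in PP].

(* Power series in q whose coefficients are polynomials in k other variables: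
   F m is the coefficient of q^m. Every series below lives there, as only
   finitely many parallelogram polyominoes have a given area; in particular the
   finitely supported sums \sum_(_ \in _) are genuine sums. *)
Definition qseries (k : nat) : Type := nat -> {mpoly rat[k]}.

Definition subst (k l : nat) (F : qseries k) (s : k.-tuple {mpoly rat[l]}) :
  qseries l := fun m => comp_mpoly s (F m).

(* The variables 'X_0, 'X_1, 'X_2 stand for v, x, y. *)
Definition P_series : qseries 3 := fun m =>
  \sum_(C \in PP `&` [set C | area (repr C) = m])
    ('X_0 ^+ last_column_height (repr C) * 'X_1 ^+ width (repr C)
      * 'X_2 ^+ height (repr C) : {mpoly rat[3]}).

(* The variables 'X_0, 'X_1 stand for x, y. *)
Definition symmetric_series (g : D2) : qseries 2 := fun m =>
  \sum_(C \in PP `&` [set C | symmetric_under g C /\ area (repr C) = m])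
    ('X_0 ^+ width (repr C) * 'X_1 ^+ height (repr C) : {mpoly rat[2]}).

Definition R2_series : qseries 2 := symmetric_series r2.
Definition D1_series : qseries 2 := symmetric_series d1.
Definition D2_series : qseries 2 := symmetric_series d2.

(* Half-perimeter and area are constant on each orbit. *)
Definition PP_mod_D2_series : qseries 1 := fun m =>
  \sum_(O \in PP_mod_D2 `&` [set O | area (repr (repr O)) = m])
    ('X_0 ^+ half_perimeter (repr (repr O)) : {mpoly rat[1]}).

Definition t : {mpoly rat[1]} := 'X_0.

(* Main.v *)
From HB Require Import structures.
From mathcomp Require Import all_boot all_order all_algebra.
From mathcomp Require Import generic_quotient finmap.
From mathcomp Require Import boolp classical_sets functions cardinality fsbigop.
From mathcomp.multinomials Require Import mpoly.
From mathcomp Require Import zify.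
Require Import Defs.

Set Implicit Arguments.
Unset Strict Implicit.
Unset Printing Implicit Defensive.

Import Order.TTheory GRing.Theory Num.Theory.

Local Open Scope quotient_scope.
Local Open Scope classical_set_scope.
Local Open Scope ring_scope.

(** This is Burnside's lemma with weights.  Fix the area m.  Substituting
    v = 1 and x = y = t turns the coefficient of q^m in each of the four series
    on the right into the sum of t^(half-perimeter) over the polyominoes of area
    m fixed by one of the four group elements, the full series being the one
    attached to the identity.  Adding them up counts every polyomino C with its
    weight times the order of its stabilizer; gathered over one orbit, this is
    the weight of the orbit times the order of the group, by the orbit-stabilizer
    theorem in the form of [sum_stabilizers].  Hence [weighted_burnside].

    Three facts make it applicable.  The isometries of the group, combined with
    translations, preserve the defining properties of a parallelogram polyomino:
    they either fix or exchange the lower left and upper right corners of the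
    bounding rectangle ([corners_isometry]), which is why only these four
    isometries of the square act.  For the same reason they preserve the
    half-perimeter, although two of them exchange width and height.  Finally,
    there are finitely many polyominoes of area m, since a connected set of m
    cells fits in a square of side 2m + 1 centred at any of its cells
    ([finite_PP_area]); so the coefficients are sums over finite sets, which may
    be exchanged and partitioned. *)

(** * Burnside's lemma for the group of four isometries *)

Definition D2_code (g : D2) : bool * bool :=
  match g with
  | id_ => (false, false) | r2 => (true, true)
  | d1 => (true, false) | d2 => (false, true)
  end.

Definition D2_decode (b : bool * bool) : D2 :=
  match b with
  | (false, false) => id_ | (true, true) => r2
  | (true, false) => d1 | (false, true) => d2
  end.

Lemma D2_codeK : cancel D2_code D2_decode. Proof. by case. Qed.
Lemma D2_decodeK : cancel D2_decode D2_code. Proof. by case=> [[] []]. Qed.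

HB.instance Definition _ := Finite.copy D2 (can_type D2_codeK).

Lemma big_D2 (V : zmodType) (F : D2 -> V) :
  \sum_(g : D2) F g = F id_ + F r2 + F d1 + F d2.
Proof.
rewrite (reindex D2_decode) /=; last first.
  by exists D2_code => ? _; [exact: D2_decodeK | exact: D2_codeK].
rewrite (eq_bigr (fun b => F (D2_decode (b.1, b.2)))) => [|[] //].
rewrite -(pair_bigA _ (fun a b => F (D2_decode (a, b)))) !big_bool /=.
by rewrite addrC [F d2 + _]addrC -addrA [F d2 + _]addrC !addrA.
Qed.

Lemma mulD2I h : injective (mulD2^~ h).
Proof. by case: h => -[] []. Qed.

Lemma orbitP (C C' : tclass) :
  \pi_congruence_class C' = \pi_congruence_class C <-> exists h, C' = act h C.
Proof.
split=> [e|[h ->]]; last first.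
  by apply/esym/eqmodP/asboolP; exists h.
have /eqmodP/asboolP[h ->] :
  \pi_congruence_class C = \pi_congruence_class C' by [].
by exists h.
Qed.

(** Orbit-stabilizer: if C = k C0, then g |-> g k maps the stabilizer of C
    bijectively onto the set of h such that h C0 = C, because k is an involution;
    and each of the four h sends C0 to exactly one C of the orbit. *)
Lemma sum_stabilizers (V : zmodType) (w : tclass -> V) (X : {fset tclass}) C0 :
  (forall g, act g C0 \in X) -> (forall g C, w (act g C) = w C) ->
  \sum_(C <- X | \pi_congruence_class C == \pi_congruence_class C0)
    \sum_(g : D2 | act g C == C) w C = w C0 *+ 4.
Proof.
move=> XC0 w_act.
transitivity (\sum_(C <- X | \pi_congruence_class C == \pi_congruence_class C0)
    \sum_(h : D2 | act h C0 == C) w C0).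
  apply: eq_bigr => C /eqP/orbitP[k ->].
  rewrite (reindex_inj (@mulD2I k)) /=.
  apply: eq_big => [g|g _]; last by rewrite w_act.
  rewrite actM; suff -> : mulD2 (mulD2 g k) k = g by [].
  by case: g; case: k.
rewrite (exchange_big_dep xpredT) //=.
rewrite (eq_bigr (fun=> w C0)) => [|h _].
  by rewrite big_D2 !mulrSr mulr0n add0r.
rewrite big_mkcond (bigD1_seq (act h C0)) ?fset_uniq //= eqxx andbT.
rewrite (introT eqP (proj2 (orbitP _ _) (ex_intro _ h erefl))) big1 ?addr0 //.
by move=> C neC; rewrite [act h C0 == C]eq_sym (negbTE neC) andbF.
Qed.

Lemma congruence_repr C : exists h, repr (\pi_congruence_class C) = act h C.
Proof. by apply/orbitP; rewrite reprK. Qed.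

(** The left-hand side sums w C over the pairs (g, C) with g C = C.  Grouping
    these pairs by the orbit of C instead of by g gives the right-hand side. *)
Lemma weighted_burnside (V : zmodType) (w : tclass -> V) (S : set tclass) :
  finite_set S -> (forall g C, S C -> S (act g C)) ->
  (forall g C, w (act g C) = w C) ->
  \sum_(g : D2) \sum_(C \in S `&` [set C | symmetric_under g C]) w C
  = (\sum_(O \in [set \pi_congruence_class C | C in S]) w (repr O)) *+ 4.
Proof.
move=> finS S_act w_act.
transitivity (\sum_(C <- fset_set S) \sum_(g : D2 | act g C == C) w C).
  rewrite (exchange_big_dep xpredT) //=; apply: eq_bigr => g _.
  rewrite fsbig_finite; last exact: finite_setIl.
  rewrite [RHS]big_fset_condE /=; apply: eq_fbigl => C.
  rewrite !inE in_fset_set; last exact: finite_setIl.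
  rewrite in_fset_set // in_setI; congr (_ && _).
  by apply/idP/eqP; rewrite inE.
rewrite (partition_big_imfset _ (fun C => \pi_congruence_class C)) /=.
rewrite fsbig_finite; last exact: finite_image.
rewrite fset_set_image // -sumrMnl; apply: eq_big_seq => O /imfsetP[/= C + ->].
rewrite in_fset_set // inE => SC.
have [h e] := congruence_repr C.
rewrite -{1}[\pi_congruence_class C]reprK sum_stabilizers // => g.
by rewrite in_fset_set // inE e; exact: S_act (S_act _ _ SC).
Qed.

(** * Bounding rectangles and their images *)

Lemma coord_min_le f (A : shape) c : c \in A -> coord_min f A <= f c.
Proof. by move=> cA; apply: ge_bigmin_seq. Qed.

Lemma coord_min_attained f (A : shape) :
  A != fset0 -> exists2 c, c \in A & coord_min f A = f c.
Proof.
move=> An0; have headA : head (0, 0) (A : seq cell) \in A.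
  case/fset0Pn: An0 => c cA; have: c \in (A : seq cell) by [].
  rewrite -[head _ _ \in A]/(head (0, 0) (A : seq cell) \in (A : seq cell)).
  by case: (enum_fset A) => //= a s _; rewrite inE eqxx.
pose K x := exists2 c, c \in A & x = f c.
rewrite /coord_min big_seq.
apply: (big_ind K) => [|x y [c cA ->] [c' c'A ->]|c cA].
- by exists (head (0, 0) (A : seq cell)).
- by rewrite minEle; case: ifP => _; [exists c | exists c'].
- by exists c.
Qed.

(** Valid for the empty shape too, as the initial value of the iterated extremum
    is itself a value of the coordinate. *)
Lemma coord_min_decr (f h : cell -> int) (a : int) (A : shape) :
  (forall c, h c = a - f c) -> coord_min h A = a - coord_max f A.
Proof.
move=> hE; apply/esym; rewrite /coord_min /coord_max hE.
rewrite (big_morph (fun x => a - x) (op1 := Order.min)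
  (id1 := a - f (head (0, 0) (A : seq cell)))) //.
  by apply: eq_bigr => c _; rewrite hE.
by move=> x y; lia.
Qed.

Lemma coord_max_decr (f h : cell -> int) (a : int) (A : shape) :
  (forall c, h c = a - f c) -> coord_max h A = a - coord_min f A.
Proof.
move=> hE; have fE c : f c = a - h c by rewrite hE subKr.
by rewrite (coord_min_decr _ fE) subKr.
Qed.

Lemma coord_min_incr (f h : cell -> int) (a : int) (A : shape) :
  (forall c, h c = f c + a) -> coord_min h A = coord_min f A + a.
Proof.
move=> hE; rewrite (@coord_min_decr (fun c => - f c) h a) => [|c];
  last by rewrite opprK addrC.
by rewrite (@coord_max_decr f _ 0) => [|c]; rewrite ?sub0r // opprK addrC.
Qed.

Lemma coord_max_incr (f h : cell -> int) (a : int) (A : shape) :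
  (forall c, h c = f c + a) -> coord_max h A = coord_max f A + a.
Proof.
move=> hE; rewrite (@coord_max_decr (fun c => - f c) h a) => [|c];
  last by rewrite opprK addrC.
by rewrite (@coord_min_decr f _ 0) => [|c]; rewrite ?sub0r // opprK addrC.
Qed.

(** Nonemptiness matters: on the empty shape the left-hand side is f (0, 0) and
    the right-hand side f (phi (0, 0)). *)
Lemma coord_min_imfset f (phi : cell -> cell) (A : shape) : A != fset0 ->
  coord_min f [fset phi c | c in A]%fset = coord_min (f \o phi) A.
Proof.
move=> An0; set B := [fset phi c | c in A]%fset.
have [c0 c0A _] := coord_min_attained f An0.
have Bn0 : B != fset0.
  by apply/fset0Pn; exists (phi c0); apply/imfsetP; exists c0.
apply/eqP; rewrite eq_le; apply/andP; split.
  have [c cA ->] := coord_min_attained (f \o phi) An0.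
  by apply: coord_min_le; apply/imfsetP; exists c.
have [_ /imfsetP[/= c cA ->] ->] := coord_min_attained f Bn0.
exact: (@coord_min_le (f \o phi)).
Qed.

Lemma coord_max_imfset f (phi : cell -> cell) (A : shape) : A != fset0 ->
  coord_max f [fset phi c | c in A]%fset = coord_max (f \o phi) A.
Proof.
move=> An0; pose f' c := 0 - f c.
have fE c : f c = 0 - f' c by rewrite subKr.
rewrite (coord_max_decr _ fE) coord_min_imfset //.
by rewrite (coord_max_decr _ (fun c => fE (phi c))).
Qed.

(** Representatives of classes are known only up to translation, so the group
    acts on them by one of its elements followed by a translation. *)
Definition isometry (g : D2) (v c : cell) : cell := shift v (move_cell g c).

Lemma translate_move g v (A : shape) :
  translate v (move g A) = [fset isometry g v c | c in A]%fset.
Proof.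
apply/fsetP => c; apply/imfsetP/imfsetP => /= -[d].
  by case/imfsetP => /= e eA -> ->; exists e.
by move=> dA ->; exists (move_cell g d) => //; apply/imfsetP; exists d.
Qed.

Lemma isometry_inj g v : injective (isometry g v).
Proof.
case=> i j [i' j']; rewrite /isometry /shift.
by case: g => /= -[? ?]; congr pair; lia.
Qed.

Lemma isometry_mem g v (A : shape) c :
  (isometry g v c \in translate v (move g A)) = (c \in A).
Proof. by rewrite translate_move mem_imfset //; exact: isometry_inj. Qed.

Lemma translate_moveP g v (A : shape) c :
  c \in translate v (move g A) -> exists2 d, d \in A & c = isometry g v d.
Proof. by rewrite translate_move => /imfsetP[/= d dA ->]; exists d. Qed.

Lemma area_isometry g v (A : shape) : area (translate v (move g A)) = area A.
Proof. by rewrite translate_move /area card_imfset //; exact: isometry_inj. Qed.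

Definition lower_left (A : shape) : cell := (xmin A, ymin A).
Definition upper_right (A : shape) : cell := (xmax A, ymax A).

(** The identity and the reflection about y = x are increasing in both
    coordinates; the rotation and the reflection about y = -x are decreasing.  So
    the pair of corners that a parallelogram polyomino must contain is preserved,
    up to exchange. *)
Lemma corners_isometry g v (A : shape) (B := translate v (move g A)) :
  A != fset0 ->
  if g is (id_ | d2)
  then lower_left B = isometry g v (lower_left A) /\
       upper_right B = isometry g v (upper_right A)
  else lower_left B = isometry g v (upper_right A) /\
       upper_right B = isometry g v (lower_left A).
Proof.
move=> An0; rewrite /lower_left /upper_right /xmin /ymin /xmax /ymax {}/B.
rewrite translate_move !coord_min_imfset // !coord_max_imfset //.
have decr_min f h (b : int) : (forall c, h c = - f c - 1 + b) ->
    coord_min h A = - coord_max f A - 1 + b.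
  move=> hE; rewrite (@coord_min_decr f h (b - 1)) => [|c]; first lia.
  by rewrite hE; lia.
have decr_max f h (b : int) : (forall c, h c = - f c - 1 + b) ->
    coord_max h A = - coord_min f A - 1 + b.
  move=> hE; rewrite (@coord_max_decr f h (b - 1)) => [|c]; first lia.
  by rewrite hE; lia.
case: g; split; congr pair; rewrite /=; first
  [exact: coord_min_incr | exact: coord_max_incr | exact: decr_min | exact: decr_max].
Qed.

Lemma half_perimeter_isometry g v (A : shape) : A != fset0 ->
  half_perimeter (translate v (move g A)) = half_perimeter A.
Proof.
move=> /(corners_isometry g v).
rewrite /half_perimeter /width /height /extent -/xmin -/xmax -/ymin -/ymax.
rewrite /lower_left /upper_right /isometry /shift.
by case: g => /= -[[-> ->] [-> ->]]; lia.
Qed.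

(** The elements of the group are involutions, so [move_cell g] also appears in
    the inverse of the isometry. *)
Lemma mem_translate_move g v (A : shape) c :
  (c \in translate v (move g A)) = (move_cell g (c.1 - v.1, c.2 - v.2) \in A).
Proof.
rewrite -(isometry_mem g v).
suff {1}-> : c = isometry g v (move_cell g (c.1 - v.1, c.2 - v.2)) by [].
by case: c => i j; rewrite /isometry /shift; case: g => /=; congr pair; lia.
Qed.

(** * Invariance of parallelogram polyominoes *)

Lemma parallelogram_isometry g v (A : shape) :
  parallelogram A -> parallelogram (translate v (move g A)).
Proof.
case=> An0 A_conn A_row A_col A_bl A_tr; split.
- have /fset0Pn[c cA] := An0.
  by apply/fset0Pn; exists (isometry g v c); rewrite isometry_mem.
- move=> _ _ /translate_moveP[c cA ->] /translate_moveP[c' c'A ->].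
  have [p [p_path p_last pA]] := A_conn _ _ cA c'A.
  exists (map (isometry g v) p); split.
  + rewrite path_map; apply: sub_path p_path => -[i j] [i' j'].
    by rewrite /adjacent /= /isometry /shift; case: (g) => /=; lia.
  + by rewrite last_map p_last.
  + by move=> _ /mapP[d /pA dA ->]; rewrite isometry_mem.
- move=> i i' k j; rewrite !mem_translate_move; case: (g) => /= iA i'A kij.
  + by apply: A_row iA i'A _; lia.
  + by apply: A_row i'A iA _; lia.
  + by apply: A_col i'A iA _; lia.
  + by apply: A_col iA i'A _; lia.
- move=> i j j' k; rewrite !mem_translate_move; case: (g) => /= jA j'A kij.
  + by apply: A_col jA j'A _; lia.
  + by apply: A_col j'A jA _; lia.
  + by apply: A_row j'A jA _; lia.
  + by apply: A_row jA j'A _; lia.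
- by case: (g) (corners_isometry g v An0) => -[+ _]; rewrite /lower_left => ->;
     rewrite isometry_mem.
- by case: (g) (corners_isometry g v An0) => -[_]; rewrite /upper_right => ->;
     rewrite isometry_mem.
Qed.

Lemma repr_pi (A : shape) : exists v, repr (\pi_tclass A) = translate v A.
Proof.
have : translation_equiv A (repr (\pi_tclass A)) by apply/eqmodP; rewrite reprK.
by move=> /asboolP[v e]; exists v.
Qed.

Lemma repr_act g C : exists v, repr (act g C) = translate v (move g (repr C)).
Proof. exact: repr_pi. Qed.

Lemma PP_act g C : PP C -> PP (act g C).
Proof.
by have [v e] := repr_act g C; rewrite /PP /= e; exact: parallelogram_isometry.
Qed.

Lemma area_act g C : area (repr (act g C)) = area (repr C).
Proof. by have [v ->] := repr_act g C; exact: area_isometry. Qed.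

Lemma half_perimeter_act g C :
  half_perimeter (repr (act g C)) = half_perimeter (repr C).
Proof.
have [v ->] := repr_act g C.
have [e|?] := eqVneq (repr C) fset0; last exact: half_perimeter_isometry.
suff -> : translate v (move g (repr C)) = repr C by [].
by rewrite translate_move e imfset0.
Qed.

(** * Finiteness *)

Lemma adjacent_path_dist (p : seq cell) c : path adjacent c p ->
  (`|(last c p).1 - c.1| <= size p)%N /\ (`|(last c p).2 - c.2| <= size p)%N.
Proof.
elim: p c => [|d p IHp] c /=; first by rewrite !subrr.
case/andP; rewrite /adjacent => cd /IHp; lia.
Qed.

Definition box (m : nat) : shape :=
  seq_fset tt [seq (i%:Z - m%:Z, j%:Z - m%:Z) |
                i <- iota 0 m.*2.+1, j <- iota 0 m.*2.+1].

Lemma mem_box m c : (c \in box m) = (`|c.1| <= m)%N && (`|c.2| <= m)%N.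
Proof.
rewrite seq_fsetE; apply/allpairsP/andP => [[[i j] []]|[c1 c2]].
  by rewrite !mem_iota => /= ? ? -> /=; lia.
exists (absz (c.1 + m%:Z), absz (c.2 + m%:Z)); rewrite !mem_iota.
by case: c c1 c2 => x y /= ? ?; split; [lia|lia|congr pair; lia].
Qed.

(** A path without repeated cells inside A has fewer steps than A has cells, and
    each step changes each coordinate by at most one. *)
Lemma connected_bounded (A : shape) c c' : connected A -> c \in A -> c' \in A ->
  shift (- c.1, - c.2) c' \in box (area A).
Proof.
move=> A_conn cA c'A; have [p [+ + pA]] := A_conn _ _ cA c'A.
case/shortenP => q /adjacent_path_dist q_dist q_uniq q_sub q_last.
have size_q : (size q < area A)%N.
  rewrite -[size q]/(size (c :: q)).-1 prednK //; apply: uniq_leq_size => // d.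
  by rewrite inE => /predU1P[->//|/q_sub/pA].
have [dx dy] := q_dist; rewrite mem_box /shift /= -q_last.
by rewrite !(leq_trans _ (ltnW size_q)).
Qed.

(** Moving a cell of the polyomino to the origin puts it inside a box that depends
    only on the area. *)
Lemma finite_PP_area m : finite_set (PP `&` [set C | area (repr C) = m]).
Proof.
apply: (@sub_finite_set _ _
  [set \pi_tclass A | A in [set` fpowerset (box m)]]).
  move=> C [/= [/fset0Pn[c cA] A_conn _ _ _ _] areaC].
  exists (translate (- c.1, - c.2) (repr C)) => /=.
    rewrite fpowersetE; apply/fsubsetP => _ /imfsetP[/= d dA ->].
    by rewrite -areaC; exact: connected_bounded.
  rewrite -[RHS]reprK; apply/esym/eqmodP/asboolP.
  by exists (- c.1, - c.2).
exact/finite_image/finite_fset.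
Qed.

(** * The generating series *)

Definition weight (C : tclass) : {mpoly rat[1]} := t ^+ half_perimeter (repr C).

Lemma subst_P_series m : subst P_series [tuple 1; t; t] m =
  \sum_(C \in (PP `&` [set C | area (repr C) = m])
      `&` [set C | symmetric_under id_ C]) weight C.
Proof.
rewrite (_ : _ `&` [set C | _] = PP `&` [set C | area (repr C) = m]); last first.
  by apply/seteqP; split=> [C []//|C SC]; split=> //; exact: act_id.
have fin := finite_PP_area m.
rewrite /subst /P_series !fsbig_finite // raddf_sum; apply: eq_bigr => C _.
by rewrite /= !rmorphM !rmorphXn /= !comp_mpolyXU /= expr1n mul1r -exprD.
Qed.

Lemma subst_symmetric_series g m : subst (symmetric_series g) [tuple t; t] m =
  \sum_(C \in (PP `&` [set C | area (repr C) = m])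
      `&` [set C | symmetric_under g C]) weight C.
Proof.
rewrite (_ : _ `&` [set C | _] =
  PP `&` [set C | symmetric_under g C /\ area (repr C) = m]); last first.
  by apply/seteqP; split=> C /=; tauto.
have fin : finite_set (PP `&` [set C | symmetric_under g C /\ area (repr C) = m]).
  by apply: sub_finite_set (finite_PP_area m) => C [? []].
rewrite /subst /symmetric_series !fsbig_finite // raddf_sum; apply: eq_bigr => C _.
by rewrite /= rmorphM !rmorphXn /= !comp_mpolyXU /= -exprD.
Qed.

(** The area of an orbit may be read off any of its members, so the orbits of
    area m are the orbits of the polyominoes of area m. *)
Lemma PP_mod_D2_area m :
  PP_mod_D2 `&` [set O | area (repr (repr O)) = m] =
  [set \pi_congruence_class C | C in PP `&` [set C | area (repr C) = m]].
Proof.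
have areaE C : area (repr (repr (\pi_congruence_class C))) = area (repr C).
  by have [h ->] := congruence_repr C; exact: area_act.
apply/seteqP; split=> [_ [[C PC <-] /=]|_ [C [PC /= aC] <-]].
  by rewrite areaE => aC; exists C.
by split; [exists C | rewrite /= areaE].
Qed.

Theorem proposition11 :
  PP_mod_D2_series =
    4^-1 *: (subst P_series [tuple 1; t; t] + subst R2_series [tuple t; t]
             + subst D1_series [tuple t; t] + subst D2_series [tuple t; t]).
Proof.
apply/funext => m; rewrite /PP_mod_D2_series PP_mod_D2_area.
set S := PP `&` _.
(* Sums and scalar multiples of series are taken coefficientwise. *)
transitivity (4^-1 *: (subst P_series [tuple 1; t; t] m
    + subst R2_series [tuple t; t] m + subst D1_series [tuple t; t] m
    + subst D2_series [tuple t; t] m)); last by [].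
rewrite subst_P_series !subst_symmetric_series -/S.
rewrite -(big_D2 (fun g => \sum_(C \in S `&` [set C | symmetric_under g C]) weight C)).
rewrite weighted_burnside.
- by rewrite -scaler_nat scalerA mulVf ?scale1r.
- exact: finite_PP_area.
- by move=> g C [PC aC]; split; [exact: PP_act|rewrite /= area_act].
- by move=> g C; rewrite /weight half_perimeter_act.
Qed.
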